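(* As $X\to\infty$, we have $$N_3'(X)=N_3(X)+O(X^{1/6}\log X).$$
   Context: $\mathcal{E}$ is the set of elliptic curves over $\mathbb{Q}$ given by equations $E_{A,B}\colon y^2=x^3+Ax+B$ with $A,B\in\mathbb{Z}$, $4A^3+27B^2\ne0$, and such that there is no prime $\ell$ with both $\ell^4\mid A$ and $\ell^6\mid B$; every elliptic curve over $\mathbb{Q}$ is isomorphic over $\mathbb{Q}$ to exactly one member of $\mathcal{E}$. The height is $\operatorname{ht}(E_{A,B})=\max(|4A^3|,|27B^2|)$, and $\mathcal{E}_{\le X}=\{E\in\mathcal{E}:\operatorname{ht}(E)\le X\}$. A $3$-isogeny is an isogeny of degree $3$. $N_3(X)$ is the number of $E\in\mathcal{E}_{\le X}$ that have a $3$-isogeny defined over $\mathbb{Q}$. $N_3'(X)$ is the number of pairs $(E,\phi)$ with $E\in\mathcal{E}_{\le X}$ and $\phi\colon E\to E'$ a $3$-isogeny defined over $\mathbb{Q}$, where isogenies from $E$ with the same kernel are identified (so that one counts pairs $(E,C)$ with $C\subset E(\overline{\mathbb{Q}})$ a $\operatorname{Gal}(\overline{\mathbb{Q}}/\mathbb{Q})$-stable subgroup of order $3$). *)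

(* Defs.v *)
From HB Require Import structures.
From mathcomp Require Import all_boot all_order all_algebra all_field.
From mathcomp Require mpoly.

Set Implicit Arguments.
Unset Strict Implicit.
Unset Printing Implicit Defensive.

Import Order.TTheory GRing.Theory Num.Theory.

Local Open Scope ring_scope.

(* The notations of mpoly clash with those of mathcomp-analysis, so that mpoly
   is imported in this module only. *)
Module Forms.
Import mpoly.

Definition ternary_poly := {mpoly rat[3]}.

Definition is_form (d : nat) (p : ternary_poly) : bool := p \is d.-homog.

Definition eval_forms (f : 'I_3 -> ternary_poly) (v : 'rV[algC]_3) : 'rV[algC]_3 :=
  \row_i mmap (ratr : rat -> algC) (fun j => v 0 j) (f i).

End Forms.

From mathcomp Require Import finmap all_classical all_reals all_analysis.
Import numFieldNormedType.Exports.
Local Open Scope classical_set_scope.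

Section Weierstrass.
Variable F : fieldType.
Implicit Types (a b : F) (P Q : option (F * F)).

Definition nonsingular a b : bool := 4 * a ^+ 3 + 27 * b ^+ 2 != 0.

(* None is the point at infinity O = [0 : 1 : 0]. *)
Definition on_curve a b P : bool :=
  if P is Some (x, y) then y ^+ 2 == x ^+ 3 + a * x + b else true.

Definition curve_points a b : set (option (F * F)) := [set P | on_curve a b P].

(* The chord-tangent law. If x1 = x2 and y1 <> - y2 for points of the curve,
   then both points are equal and y1 <> 0. *)
Definition curve_add a P Q : option (F * F) :=
  match P, Q with
  | None, _ => Q
  | _, None => P
  | Some (x1, y1), Some (x2, y2) =>
    if (x1 == x2) && (y1 == - y2) then None else
    let m := if x1 == x2 then (3 * x1 ^+ 2 + a) / (2 * y1)
             else (y2 - y1) / (x2 - x1) in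
    let x3 := m ^+ 2 - x1 - x2 in
    Some (x3, m * (x1 - x3) - y1)
  end.

Definition homog_coords P : 'rV[F]_3 :=
  if P is Some (x, y) then \row_i [:: x; y; 1]`_i else \row_i [:: 0; 1; 0]`_i.

End Weierstrass.

(* algC plays the role of the algebraic closure of Q. *)
Notation Qbar_point := (option (algC * algC)).

Definition Qbar_points (a b : rat) : set Qbar_point :=
  curve_points (ratr a : algC) (ratr b).

(* phi, restricted to the points of E_{a,b}, is a morphism of projective
   curves over Q: around every point it is given by three forms of the same
   degree with coefficients in Q. *)
Definition morphism_over_Q (a b : rat) (phi : Qbar_point -> Qbar_point) : Prop :=
  forall P, Qbar_points a b P ->
  exists (d : nat) (f : 'I_3 -> Forms.ternary_poly),
    [/\ forall i, Forms.is_form d (f i),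
        Forms.eval_forms f (homog_coords P) != 0 &
        forall Q, Qbar_points a b Q -> Forms.eval_forms f (homog_coords Q) != 0 ->
          exists c : algC,
            Forms.eval_forms f (homog_coords Q) = c *: homog_coords (phi Q)].

(* Only the values of phi on the points of E_{a,b} matter. *)
Definition isogeny_over_Q (a b a' b' : rat) (phi : Qbar_point -> Qbar_point) :
    Prop :=
  [/\ forall P, Qbar_points a b P -> Qbar_points a' b' (phi P),
      morphism_over_Q a b phi,
      forall P Q, Qbar_points a b P -> Qbar_points a b Q ->
        phi (curve_add (ratr a) P Q) = curve_add (ratr a') (phi P) (phi Q) &
      exists2 P, Qbar_points a b P & phi P != None].

Definition isogeny_kernel (a b : rat) (phi : Qbar_point -> Qbar_point) :
    set Qbar_point :=
  [set P | Qbar_points a b P /\ phi P = None].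

(* In characteristic 0 isogenies are separable, so that the degree is the order
   of the kernel. *)
Definition three_isogeny_over_Q (a b : rat) (phi : Qbar_point -> Qbar_point) :
    Prop :=
  exists a' b' : rat,
    [/\ nonsingular a' b', isogeny_over_Q a b a' b' phi &
        (isogeny_kernel a b phi #= `I_3)%card].

(* E_{A,B} is represented by (A, B). *)
Definition calE : set (int * int) :=
  [set E | nonsingular (E.1%:~R : rat) E.2%:~R /\
    ~ exists l : nat,
      [/\ prime l, (l%:Z ^+ 4 %| E.1)%Z & (l%:Z ^+ 6 %| E.2)%Z]].

Definition height (E : int * int) : int :=
  Num.max `|4 * E.1 ^+ 3| `|27 * E.2 ^+ 2|.

Definition calE_le (R : realType) (X : R) : set (int * int) :=
  [set E | calE E /\ (height E)%:~R <= X].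

(* fset_set is empty on infinite sets; the sets counted here are finite. *)
Definition N3 (R : realType) (X : R) : nat :=
  #|` fset_set [set E | calE_le X E /\
      exists phi, three_isogeny_over_Q E.1%:~R E.2%:~R phi]|%fset.

(* Isogenies from E are identified when they have the same kernel: the pair
   (E, C) stands for the class of the 3-isogenies from E with kernel C. *)
Definition N3' (R : realType) (X : R) : nat :=
  #|` fset_set [set EC : (int * int) * set Qbar_point |
      calE_le X EC.1 /\
      exists2 phi, three_isogeny_over_Q EC.1.1%:~R EC.1.2%:~R phi &
        EC.2 = isogeny_kernel EC.1.1%:~R EC.1.2%:~R phi]|%fset.

(* Main.v *)
(* A 3-isogeny over Q has a Galois-stable kernel {O, P, -P}, so x(P) is a rational
   root of the 3-division polynomial 3x^4 + 6Ax^2 + 12Bx - A^2, and x(P) determines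
   the kernel. Hence N_3'(X) - N_3(X) is at most the number of (E, x) for which the
   division polynomial has a second rational root. If r <> s are both roots, then
   eliminating B gives (A + 3rs)^2 = -3rs(r - s)^2, so -3rs is a square; as 3r and 3s
   are integers, r = e b^2 / 9 and s = - e a^2 / 3 with integers e, a, b, which also
   determine A and B. The roots are at most 3 X^(1/6) in absolute value, so |e| a^2
   and |e| b^2 are O(X^(1/6)); for a given e there are O(X^(1/6) / |e|) pairs (a, b),
   and summing over e gives the logarithm. *)
From HB Require Import structures.
Require Import Defs.
From mathcomp Require Import all_boot all_order all_algebra all_field.
From mathcomp Require mpoly.
From mathcomp Require Import finmap.
From mathcomp Require Import all_classical all_reals all_analysis.
From mathcomp Require Import ring lra zify.
Import Order.TTheory GRing.Theory Num.Theory.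
Import numFieldNormedType.Exports.

Set Implicit Arguments.
Unset Strict Implicit.
Unset Printing Implicit Defensive.

Local Open Scope classical_set_scope.
Local Open Scope ring_scope.

(** * Elements of [algC] fixed by all automorphisms *)

(** Automorphisms of [algC] will come from extending Galois automorphisms of a normal number field,
    so x is placed in one: the field generated by the roots of its minimal polynomial. *)
Lemma splitting_num_field (x : algC) :
  {L : splittingFieldType rat & {LC : {rmorphism L -> algC} & {y | LC y = x}}}.
Proof.
have [p [Dp mon_p] _] := minCpolyP x.
have [s Ds] := closed_field_poly_normal (minCpoly x).
rewrite (monicP (minCpoly_monic x)) scale1r in Ds.
have [L [LC [s1 Ds1 genL]]] := num_field_exists s.
have splitL : splitting_field_axiom L.
  exists (map_poly (in_alg L) p).
    by apply/polyOver1P; exists p.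
  exists s1; last exact: genL.
  suff -> : map_poly (in_alg L) p = \prod_(z <- s1) ('X - z%:P) by exact: eqpxx.
  apply: (map_poly_inj LC); rewrite -map_poly_comp.
  rewrite (eq_map_poly (g := ratr)); last first.
    by move=> a /=; rewrite alg_num_field fmorph_rat.
  rewrite -Dp Ds -Ds1 big_map rmorph_prod; apply: eq_bigr => z _ /=.
  by rewrite rmorphB /= map_polyX map_polyC.
pose LM := FieldExt_isSplittingField.Build _ L splitL.
pose Ls : splittingFieldType rat := HB.pack L LM.
exists Ls, LC; suff : x \in s by rewrite -Ds1 => /mapP/sig2_eqW[y _ ->]; exists y.
by rewrite -root_prod_XsubC -Ds root_minCpoly.
Qed.

(** Let y be the copy of x in a splitting field L. Galois automorphisms of L extend to [algC], hence
    fix y; as they reach every root of the minimal polynomial of y, that polynomial is (X - y)^n.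
    Its coefficient of degree n - 1 is - n y, so y is rational. *)
Lemma fixed_algC_rat (x : algC) :
  (forall nu : {rmorphism algC -> algC}, nu x = x) -> exists q : rat, x = ratr q.
Proof.
move=> fix_x; have [L [LC [y Dx]]] := splitting_num_field x.
have fix_gal (g : gal_of {:L}) : g y = y.
  have [nu Dnu] := extend_algC_subfield_aut LC g.
  by apply: (fmorph_inj LC); rewrite Dnu Dx fix_x.
have [r /eqP Dr] := splitting_field_normal 1%AS y.
have r_y z : z \in r -> z = y.
  rewrite -root_prod_XsubC -Dr => rz.
  have [g _ <-] := normalField_root_minPoly (subvf _) (normalFieldf 1%AS) (memvf y) rz.
  by rewrite fix_gal.
have r_gt0 : (0 < size r)%N.
  have := root_minPoly 1%AS y; rewrite Dr root_prod_XsubC.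
  by case: (r).
have := polyOverP (minPolyOver 1%AS y) (size r).-1.
rewrite Dr coefPn_prod_XsubC ?lt0n_neq0 // big_seq.
rewrite (eq_bigr (fun=> y)) => [|z /r_y //].
rewrite -big_seq big_const_seq iter_addr_0 count_predT -scaler_nat.
rewrite rpredN rpredZeq pnatr_eq0 (gtn_eqF r_gt0) => /vlineP[q Dy].
by exists q; rewrite -Dx Dy alg_num_field fmorph_rat.
Qed.

Lemma eval_forms_aut (nu : {rmorphism algC -> algC}) f v :
  Forms.eval_forms f (map_mx nu v) = map_mx nu (Forms.eval_forms f v).
Proof.
apply/rowP => i; rewrite !mxE /mpoly.mmap rmorph_sum; apply: eq_bigr => m _ /=.
rewrite rmorphM fmorph_rat /mpoly.mmap1 rmorph_prod; congr (_ * _).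
by apply: eq_bigr => j _; rewrite rmorphXn mxE.
Qed.

Lemma card_I3_rem {T : Type} (A : set T) (t : T) : (A #= `I_3)%card -> A t ->
  exists p q, [/\ p <> t, q <> t, p <> q & A = [set t; p; q]].
Proof.
move=> /card_set_bijP[f [fI finj fsurj]] At.
have [u0 Au0 f0] := fsurj 0%N isT; have [u1 Au1 f1] := fsurj 1%N isT.
have [u2 Au2 f2] := fsurj 2%N isT.
have Au v : A v -> [\/ v = u0, v = u1 | v = u2].
  move=> Av; have : (f v < 3)%N by exact: fI.
  by case Dv: (f v) => [|[|[|//]]] _; [apply: Or31|apply: Or32|apply: Or33];
    apply: finj; rewrite ?inE ?f0 ?f1 ?f2.
have n01 : u0 <> u1 by move=> E; rewrite E f1 in f0.
have n02 : u0 <> u2 by move=> E; rewrite E f2 in f0.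
have n12 : u1 <> u2 by move=> E; rewrite E f2 in f1.
have [->|->|->] := Au t At; [exists u1, u2|exists u0, u2|exists u0, u1];
  split=> //; do ?[by move/esym]; apply/seteqP; split=> [v /Au[]->|v [[|]|]->] //=; tauto.
Qed.

(** * The 3-division polynomial and the chord-tangent law *)

Definition three_division {F : comNzRingType} (a b x : F) : F :=
  3 * x ^+ 4 + 6 * a * x ^+ 2 + 12 * b * x - a ^+ 2.

Section ChordTangent.
Variable F : numFieldType.
Implicit Types a b x y : F.

Lemma eqr_opp y : (y == - y) = (y == 0).
Proof. by rewrite -addr_eq0 -mulr2n mulrn_eq0. Qed.

Lemma curve_add_self a P : curve_add a P P = P -> P = None.
Proof.
case: P => [[x y]|] //=; rewrite eqxx /=; case: ifP => // /negbT ny [-> ].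
by rewrite subrr mulr0 add0r => /esym/eqP; rewrite (negPf ny).
Qed.

(** [isogeny_kernel_add] asks that the sum lie on the curve. It is applied to doubles, covered here,
    and to sums of two points of order 2, covered by [curve_add_two_torsion]. *)
Lemma on_curve_double a b P : on_curve a b P -> on_curve a b (curve_add a P P).
Proof.
case: P => [[x y]|] // /eqP E; rewrite /= eqxx /=; case: ifP => //.
rewrite eqr_opp => /negbT ny; apply/eqP.
set m := (_ / _); set x3 := (_ - x - x).
have Dm : 2 * y * m = 3 * x ^+ 2 + a by rewrite /m; field; rewrite ny.
have Dm2 : m ^+ 2 = x3 + x + x by rewrite /x3; ring.
transitivity (m ^+ 2 * (x - x3) ^+ 2 - 2 * y * m * (x - x3) + y ^+ 2); first by ring.
by rewrite Dm Dm2 E; ring.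
Qed.

(** If m is the slope of the tangent, equality of the x-coordinates says m^2 = 3x. Multiplying by
    4y^2 and replacing y^2 by the cubic gives the division polynomial. *)
Lemma curve_add_self_opp a b x y : on_curve a b (Some (x, y)) -> y != 0 ->
  curve_add a (Some (x, y)) (Some (x, y)) = Some (x, - y) ->
  three_division a b x = 0.
Proof.
move=> /eqP Exy ny; rewrite /= eqxx eqr_opp (negPf ny) /= => -[Dx _].
have Dm : ((3 * x ^+ 2 + a) / (2 * y)) ^+ 2 = 3 * x.
  by apply/eqP; rewrite -subr_eq0 -(subrr x) -{3}Dx; apply/eqP; ring.
have Dm2 : (3 * x ^+ 2 + a) ^+ 2 = 3 * x * (4 * y ^+ 2).
  by rewrite -Dm; field; rewrite ny.
rewrite Exy in Dm2; rewrite /three_division.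
by transitivity (3 * x * (4 * (x ^+ 3 + a * x + b)) - (3 * x ^+ 2 + a) ^+ 2);
  [ring | rewrite Dm2 subrr].
Qed.

(** The roots of the cubic sum to 0, so x3 = - x1 - x2 is the third one. It is distinct from the
    others because 4a^3 + 27b^2 = - ((x1 - x2)(x1 - x3)(x2 - x3))^2. *)
Lemma curve_add_two_torsion a b x1 x2 : nonsingular a b ->
  on_curve a b (Some (x1, 0)) -> on_curve a b (Some (x2, 0)) -> x1 != x2 ->
  exists2 x3, curve_add a (Some (x1, 0)) (Some (x2, 0)) = Some (x3, 0) &
    on_curve a b (Some (x3, 0)) && ((x3 != x1) && (x3 != x2)).
Proof.
move=> ns /eqP E1 /eqP E2 n12; rewrite /= (negPf n12) /=.
exists (- x1 - x2); first by congr (Some (_, _)); ring.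
have Da : a = - (x1 ^+ 2 + x1 * x2 + x2 ^+ 2).
  have d0 : x1 - x2 != 0 by rewrite subr_eq0.
  apply: (mulfI d0); apply/eqP; rewrite -subr_eq0; apply/eqP.
  transitivity ((x1 ^+ 3 + a * x1 + b) - (x2 ^+ 3 + a * x2 + b)); first by ring.
  by rewrite -E1 -E2 subrr.
have Db : b = x1 * x2 * (x1 + x2).
  by transitivity (0 ^+ 2 - x1 ^+ 3 - a * x1); [rewrite E1; ring | rewrite Da; ring].
apply/andP; split; first by apply/eqP; rewrite Da Db; ring.
rewrite -negb_or; apply: contra ns => h.
have {}h : (x1 + x1 + x2) * (x1 + x2 + x2) = 0.
  apply/eqP; rewrite mulf_eq0; case/orP: h => /eqP h.
    by rewrite -{1}h; apply/orP; left; apply/eqP; ring.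
  by rewrite -{2}h; apply/orP; right; apply/eqP; ring.
apply/eqP; transitivity (- (((x1 + x1 + x2) * (x1 + x2 + x2)) * (x1 - x2)) ^+ 2).
  by rewrite Da Db; ring.
by rewrite h mul0r expr0n oppr0.
Qed.

End ChordTangent.

(** * Kernels of 3-isogenies over Q *)

Lemma isogeny_kernel0 a b a' b' phi : isogeny_over_Q a b a' b' phi ->
  isogeny_kernel a b phi None.
Proof.
move=> [_ _ phiD _]; split; first by [].
by have /= /esym/curve_add_self := phiD None None isT isT.
Qed.

Lemma isogeny_kernel_add a b a' b' phi (P Q : Qbar_point) :
  isogeny_over_Q a b a' b' phi ->
  Qbar_points a b (curve_add (ratr a) P Q) ->
  isogeny_kernel a b phi P -> isogeny_kernel a b phi Q ->
  isogeny_kernel a b phi (curve_add (ratr a) P Q).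
Proof. by move=> [_ _ phiD _] EPQ [EP P0] [EQ Q0]; split=> //; rewrite phiD ?P0. Qed.

Lemma homog_coords_aut (nu : {rmorphism algC -> algC}) (P : Qbar_point) :
  map_mx nu (homog_coords P) =
  homog_coords (omap (fun p => (nu p.1, nu p.2)) P).
Proof.
by apply/rowP; case: P => [[x y]|] [[|[|[|//]]] i]; rewrite !mxE /= ?rmorph0 ?rmorph1.
Qed.

(** The forms that give phi around P have rational coefficients, so their values at nu(P) are the
    images under nu of their values at P: still not all zero, and with third coordinate 0. Affine
    points have third coordinate 1, so phi(nu(P)) = O. *)
Lemma isogeny_kernel_aut (nu : {rmorphism algC -> algC}) a b a' b' phi P :
  isogeny_over_Q a b a' b' phi -> isogeny_kernel a b phi P ->
  isogeny_kernel a b phi (omap (fun p => (nu p.1, nu p.2)) P).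
Proof.
move=> [_ phiQ _ _] [EP P0]; set Q := omap _ P.
have EQ : Qbar_points a b Q.
  rewrite /Q; case: P {P0 Q} EP => [[x y]|] //= /eqP E; apply/eqP.
  by rewrite -rmorphXn E !rmorphD rmorphXn rmorphM !fmorph_rat.
split=> //; have [d [f [_ fP fphi]]] := phiQ P EP.
have fQ : Forms.eval_forms f (homog_coords Q) =
    map_mx nu (Forms.eval_forms f (homog_coords P)).
  by rewrite -homog_coords_aut eval_forms_aut.
have fQ0 : Forms.eval_forms f (homog_coords Q) != 0 by rewrite fQ map_mx_eq0.
have [c Dc] := fphi Q EQ fQ0; have [c' Dc'] := fphi P EP fP.
case DQ: (phi Q) => [[x y]|] //; case/eqP: fQ0.
rewrite Dc DQ; suff -> : c = 0 by rewrite scale0r.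
move: Dc; rewrite fQ Dc' P0 DQ => /rowP/(_ (inord 2)).
by rewrite !mxE inordK //= mulr0 rmorph0 mulr1.
Qed.

(** When x is a root of the division polynomial this is {O, P, -P} with x(P) = x. Leaving y out lets
    a rational number encode the subgroup. *)
Definition order3_subgroup (a b x : rat) : set Qbar_point :=
  [set P | Qbar_points a b P /\ if P is Some (x', _) then x' = ratr x else True].

Lemma three_isogeny_kernel (a b : rat) phi : nonsingular a b ->
  three_isogeny_over_Q a b phi ->
  exists2 x : rat, three_division a b x = 0 &
    isogeny_kernel a b phi = order3_subgroup a b x.
Proof.
move=> ns [a' [b' [_ phiI K3]]].
have := card_I3_rem K3 (isogeny_kernel0 phiI).
move=> [[[x1 y1]|] [[[x2 y2]|] [nP nQ nPQ DK]]] //.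
set K := isogeny_kernel a b phi in DK *; set P := Some (x1, y1) in nPQ DK *.
set Q := Some (x2, y2) in nPQ DK *.
have KP : K P by rewrite DK /=; tauto.
have KQ : K Q by rewrite DK /=; tauto.
have KE R : K R -> Qbar_points a b R by case.
have Kopp x y : K (Some (x, y)) -> K (Some (x, - y)).
  move=> Kxy; have [Exy xy0] := Kxy; have ENxy : Qbar_points a b (Some (x, - y)).
    by move: Exy; rewrite /Qbar_points /curve_points /= sqrrN.
  split=> //; have [_ _ phiD _] := phiI; have := phiD _ _ Exy ENxy.
  by rewrite xy0 /= eqxx opprK eqxx /= => <-; have [] := isogeny_kernel0 phiI.
have nsC : nonsingular (ratr a : algC) (ratr b).
  move: ns; rewrite /nonsingular -(fmorph_eq0 (@ratr algC)).
  by rewrite rmorphD !(rmorphXn, rmorphM) !rmorph_nat.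
(* If P had order 2, then -Q, which lies in the kernel, could only be Q; so Q would have order 2 as
   well, and P + Q would be a fourth element of the kernel. *)
have y1n0 : y1 != 0.
  apply/eqP => y10; have y20 : y2 = 0.
    have := Kopp _ _ KQ; rewrite DK => -[[//|]|] [].
      move=> Dx /eqP; rewrite y10 oppr_eq0 => /eqP Dy.
      by case: nPQ; rewrite /P /Q Dx Dy y10.
    by move/esym/eqP; rewrite eqr_opp => /eqP.
  rewrite /P /Q y10 y20 in nPQ DK KP KQ.
  have n12 : x1 != x2 by apply/eqP => x12; case: nPQ; rewrite x12.
  have [x3 DPQ /and3P[E3 /eqP n31 /eqP n32]] :=
    curve_add_two_torsion nsC (KE _ KP) (KE _ KQ) n12.
  have := isogeny_kernel_add phiI _ KP KQ; rewrite DPQ => /(_ E3).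
  by rewrite -/K DK => -[[//|[/n31]]|[/n32]].
have DQ : Q = Some (x1, - y1).
  have := Kopp _ _ KP; rewrite DK => -[[//|[]]|-> //].
  by move/esym/eqP; rewrite eqr_opp (negPf y1n0).
have D2P : curve_add (ratr a) P P = Q.
  have := isogeny_kernel_add phiI (on_curve_double (KE _ KP)) KP KP.
  rewrite -/K DK => -[[|]|//].
    by rewrite /P /= eqxx eqr_opp (negPf y1n0).
  by move/curve_add_self.
(* An automorphism sends P to P or -P, which share their x-coordinate. *)
have /fixed_algC_rat[q Dq] (nu : {rmorphism algC -> algC}) : nu x1 = x1.
  have := isogeny_kernel_aut nu phiI KP; rewrite -/K DK /= => -[[//|[]//]|].
  by rewrite DQ => -[].
exists q.
  have := curve_add_self_opp (KE _ KP) y1n0; rewrite -/P -DQ => /(_ D2P).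
  rewrite Dq /three_division => h; apply: (fmorph_inj (@ratr algC)).
  by rewrite rmorph0 -h rmorphB !rmorphD !(rmorphXn, rmorphM) !rmorph_nat.
apply/seteqP; split=> [R KR|[[x y]|] [ER]] /=.
- split; first exact: KE; move: KR; rewrite DK => -[[|]|] -> //.
  by rewrite DQ.
- move=> Dx; rewrite -/K DK /= /P DQ Dq -Dx.
  have /eqP EP := KE _ KP; move/eqP: ER; rewrite Dx -Dq -EP => /eqP.
  by rewrite eqf_sqr => /orP[]/eqP->; tauto.
- by move=> _; exact: isogeny_kernel0 phiI.
Qed.

(** * Integrality and parametrization of pairs of rational roots *)

Lemma quartic_root_int (c2 c1 c0 : int) (t : rat) :
  t ^+ 4 + c2%:~R * t ^+ 2 + c1%:~R * t + c0%:~R = 0 -> exists n : int, t = n%:~R.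
Proof.
move=> h; set n := numq t; set d := denq t.
have d0 : d%:~R != 0 :> rat by rewrite intr_eq0 denq_neq0.
have Dt : t = n%:~R / d%:~R by rewrite divq_num_den.
have Dn : n ^+ 4 = (- (c2 * n ^+ 2 * d + c1 * n * d ^+ 2 + c0 * d ^+ 3)) * d.
  apply: (@intr_inj rat).
  have Dn : n%:~R = t * d%:~R by rewrite Dt divfK.
  rewrite !(rmorphN, rmorphXn, rmorphM, rmorphD) /= Dn.
  apply/eqP; rewrite -subr_eq0; apply/eqP.
  by rewrite -[RHS](mulr0 (d%:~R ^+ 4)) -h; ring.
have d_n : (d %| n ^+ 4)%Z by rewrite Dn dvdz_mull.
exists n; rewrite Dt; suff -> : d = 1 by rewrite divr1.
have co : coprimez d (n ^+ 4).
  by rewrite coprimezXr // coprimez_sym /coprimez; exact: coprime_num_den.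
have := denq_gt0 t; rewrite -/d => d_gt0.
move: co; rewrite /coprimez (gcdz_idPl d_n) => /eqP.
by rewrite gtz0_abs.
Qed.

Lemma three_division_root_int (A B : int) (r : rat) :
  three_division A%:~R B%:~R r = 0 -> exists n : int, 3 * r = n%:~R.
Proof.
(* 27 times the division polynomial is a monic integral quartic in 3r. *)
move=> h; apply: (@quartic_root_int (18 * A) (108 * B) (- 27 * A ^+ 2)).
rewrite !(rmorphM, rmorphXn, rmorphN) /=.
transitivity (27 * three_division A%:~R B%:~R r); last by rewrite h mulr0.
by rewrite /three_division; ring.
Qed.

(** From u a^2 + v b^2 = 1 one gets c = u (c a^2) + v (c b^2). *)
Lemma coprime_sqr_int (a b : int) (c : rat) : coprimez a b ->
  (exists m : int, c * a%:~R ^+ 2 = m%:~R) ->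
  (exists n : int, c * b%:~R ^+ 2 = n%:~R) -> exists k : int, c = k%:~R.
Proof.
move=> co [m Dm] [n Dn].
have /coprimezP[[u v] /= uv1] : coprimez (a ^+ 2) (b ^+ 2).
  by rewrite coprimezXl ?coprimezXr.
exists (u * m + v * n); rewrite rmorphD !rmorphM /= -Dm -Dn.
transitivity (c * (u * a ^+ 2 + v * b ^+ 2)%:~R); first by rewrite uv1 mulr1.
by rewrite !(rmorphD, rmorphM, rmorphXn) /=; ring.
Qed.

Section TwoRoots.
Variables (F : numFieldType) (A B r s : F).
Hypotheses (r_root : three_division A B r = 0) (s_root : three_division A B s = 0).
Hypothesis neq_rs : r != s.

Lemma two_roots_B : B = - (r + s) * (r ^+ 2 + s ^+ 2 + 2 * A) / 4.
Proof.
have d0 : r - s != 0 by rewrite subr_eq0.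
apply: (mulfI d0); apply/eqP; rewrite -subr_eq0; apply/eqP.
transitivity ((three_division A B r - three_division A B s) / 12).
  by rewrite /three_division; field.
by rewrite r_root s_root subrr mul0r.
Qed.

Lemma two_roots_A : (A + 3 * r * s) ^+ 2 = - 3 * r * s * (r - s) ^+ 2.
Proof.
apply/eqP; rewrite -subr_eq0; apply/eqP; transitivity (- three_division A B r).
  by rewrite /three_division two_roots_B; field.
by rewrite r_root oppr0.
Qed.

End TwoRoots.

Lemma two_roots_param (A B : int) (r s : rat) :
  three_division A%:~R B%:~R r = 0 -> three_division A%:~R B%:~R s = 0 -> r != s ->
  exists e a b : int,
    [/\ e != 0, (a != 0) || (b != 0), r = e%:~R * b%:~R ^+ 2 / 9,
        s = - e%:~R * a%:~R ^+ 2 / 3 &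
        A%:~R = e%:~R ^+ 2 * a%:~R * b%:~R *
          (b%:~R ^+ 2 + 3 * a%:~R * b%:~R + 3 * a%:~R ^+ 2) / 27 :> rat].
Proof.
move=> r_root s_root neq_rs; have DA := two_roots_A r_root s_root neq_rs.
have [m Dm] := three_division_root_int r_root.
have [n Dn] := three_division_root_int s_root.
(* The general choice below divides by r. If r = 0 then A = 0, and e = - 3s, a = 1, b = 0 work. *)
have [r0|r0] := eqVneq r 0.
  exists (- n), 1, 0; split=> //.
  - rewrite oppr_eq0 -(intr_eq0 rat) -Dn mulf_neq0 //.
    by rewrite -r0 eq_sym.
  - by rewrite r0 expr0n mulr0 mul0r.
  - by rewrite rmorphN /= -Dn; field.
  - by move: DA; rewrite r0 !(mulr0, mul0r, addr0) => /eqP; rewrite sqrf_eq0 => /eqP ->.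
have d0 : r - s != 0 by rewrite subr_eq0.
(* This particular square root of - 3rs makes A = - 3rs + w (r - s) hold without a sign ambiguity;
   the sign of w passes to a. *)
pose w := (A%:~R + 3 * r * s) / (r - s).
have Dw2 : w ^+ 2 = - 3 * r * s by rewrite /w expr_div_n DA mulfK // expf_neq0.
have {}DA : A%:~R = - 3 * r * s + w * (r - s) by rewrite /w divfK //; ring.
(* In lowest terms u = a / b, and s = - 3r u^2. *)
pose u := w / (3 * r); set a := numq u; set b := denq u.
have b0 : b%:~R != 0 :> rat by rewrite intr_eq0 denq_neq0.
have Dab : w = 3 * r * (a%:~R / b%:~R) by rewrite divq_num_den /u; field; rewrite r0.
have Ds : s = - 3 * r * (a%:~R / b%:~R) ^+ 2.
  have r3 : - 3 * r != 0 by rewrite mulf_neq0.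
  by apply: (mulfI r3); rewrite -Dw2 Dab; ring.
pose c := 9 * r / b%:~R ^+ 2.
(* Both c a^2 = - 3s and c b^2 = 9r are integers, and a, b are coprime. *)
have [e De] : exists e : int, c = e%:~R.
  apply: (@coprime_sqr_int a b).
  - exact: coprime_num_den.
  - by exists (- n); rewrite rmorphN /= -Dn Ds /c; field; rewrite b0.
  - by exists (3 * m); rewrite rmorphM /= -Dm /c; field; rewrite b0.
exists e, a, b; rewrite -De /c; split.
- by rewrite -(intr_eq0 rat) -De /c mulf_neq0 ?invr_eq0 ?expf_neq0 ?mulf_neq0.
- by rewrite denq_neq0 orbT.
- by field; rewrite b0.
- by rewrite Ds; field; rewrite b0.
- by rewrite DA Dab Ds; field; rewrite b0.
Qed.

(** * Size of the roots *)

(** If |r| = 3k with k > H, then |A| <= k^2 and |B| <= k^3. The leading term is 243 k^4 in absolute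
    value, while the others add up to at most (1 + 54 + 36) k^4 = 91 k^4. *)
Lemma three_division_root_le (R : realFieldType) (A B r H : R) : 0 <= H ->
  `|A| <= H ^+ 2 -> `|B| <= H ^+ 3 -> three_division A B r = 0 -> `|r| <= 3 * H.
Proof.
move=> H0 hA hB h; rewrite leNgt; apply/negP => Hr.
have t0 : 0 < `|r| by apply: le_lt_trans Hr; rewrite mulr_ge0.
pose k : R := `|r| / 3; have kH : H <= k by rewrite /k; lra.
have k0 : 0 < k by rewrite /k; lra.
have Dr : `|r| = 3 * k by rewrite /k; field.
have Hn n : H ^+ n <= k ^+ n by rewrite lerXn2r // nnegrE // ltW.
have E3 : 3 * `|r| ^+ 4 = `|A ^+ 2 - 6 * A * r ^+ 2 - 12 * B * r|.
  rewrite -normrX -[3]ger0_norm // -normrM -(subr0 (3 * _)) -h /three_division.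
  by congr `|_|; ring.
have : `|A ^+ 2 - 6 * A * r ^+ 2 - 12 * B * r| <=
    `|A| ^+ 2 + 6 * `|A| * `|r| ^+ 2 + 12 * `|B| * `|r|.
  apply: (le_trans (ler_normB _ _)); rewrite lerD //; last first.
    by rewrite !normrM ger0_norm.
  apply: (le_trans (ler_normB _ _)); rewrite lerD ?normrX //.
  by rewrite normrM normrX normrM ger0_norm.
rewrite -E3 Dr leNgt => /negP; apply.
have hA2 : `|A| ^+ 2 <= k ^+ 4.
  by rewrite (exprM _ 2 2) lerXn2r ?nnegrE ?(le_trans hA) ?exprn_ge0 ?(ltW k0).
have hA1 : `|A| * k ^+ 2 <= k ^+ 4.
  by rewrite (exprD _ 2 2) ler_wpM2r ?exprn_ge0 ?(ltW k0) // (le_trans hA).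
have hB1 : `|B| * k <= k ^+ 4.
  by rewrite (exprSr _ 3) ler_wpM2r ?(ltW k0) // (le_trans hB).
have : 0 < k ^+ 4 by rewrite exprn_gt0.
by clear E3; clearbody k; lra.
Qed.

(** * Counting the parameters (e, a, b) *)

Lemma harmonic_sum_le (R : realType) (n : nat) : (0 < n)%N ->
  \sum_(1 <= i < n.+1) i%:R^-1 <= 1 + ln n%:R :> R.
Proof.
elim: n => // -[|n] IHn _; first by rewrite big_nat1 invr1 ln1 addr0.
rewrite big_nat_recr //=; apply: (le_trans (lerD (IHn isT) (lexx _))).
rewrite -addrA lerD2l; set m : R := n.+1%:R.
have m0 : 0 < m by rewrite ltr0n.
have Dm : n.+2%:R = m + 1 :> R by rewrite -natr1.
(* This is 1 / (m + 1) <= ln (m + 1) - ln m, the inductive step. *)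
have : ln (1 + - (m + 1)^-1) <= - (m + 1)^-1.
  by apply: le_ln1Dx; rewrite ltrN2 invf_lt1; lra.
have -> : 1 + - (m + 1)^-1 = m / (m + 1) by field; lra.
rewrite lnM ?posrE ?invr_gt0 ?addr_gt0 // lnV ?posrE ?addr_gt0 // Dm; lra.
Qed.

Definition int_range (k : nat) : seq int :=
  [seq i%:Z - k%:Z | i <- iota 0 (k.*2.+1)].

Lemma mem_int_range k (a : int) : (a \in int_range k) = (`|a| <= k%:Z).
Proof.
apply/mapP/idP => [[i] | ].
  rewrite mem_iota add0n ltnS => /andP[_ ik] ->.
  by rewrite ler_norml; apply/andP; split; lia.
rewrite ler_norml => /andP[ka ak]; exists (absz (a + k%:Z)).
  by rewrite mem_iota add0n; lia.
by lia.
Qed.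

Section ParameterBox.
Variable R : realType.
Implicit Types X Y : R.

Definition box_side Y (n : nat) : nat := Num.truncn (Num.sqrt (Y / n%:R)).

(** The list is grouped by n = |e|, so that its size becomes a sum over n. *)
Definition params Y : seq (int * (int * int)) :=
  flatten [seq [seq (e, ab) | e <- [:: n%:Z; - n%:Z],
                  ab <- [seq (a, b) | a <- int_range (box_side Y n),
                                      b <- int_range (box_side Y n)]]
          | n <- iota 1 (Num.truncn Y)].

Lemma mem_box_side Y n (a : int) : 0 <= Y -> (0 < n)%N ->
  n%:R * a%:~R ^+ 2 <= Y -> a \in int_range (box_side Y n).
Proof.
move=> Y0 n0 h; rewrite mem_int_range /box_side.
rewrite -[leLHS]/(Posz `|a|) lez_nat truncn_ge_nat ?sqrtr_ge0 //.
rewrite -[leLHS]ger0_norm // -sqrtr_sqr ler_wsqrtr // ler_pdivlMr ?ltr0n //.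
by rewrite mulrC natr_absz intr_norm real_normK ?num_real.
Qed.

(** One of a^2, b^2 is at least 1, which forces |e| <= Y. *)
Lemma mem_params Y (e a b : int) : 0 <= Y -> e != 0 -> (a != 0) || (b != 0) ->
  `|e|%:~R * a%:~R ^+ 2 <= Y -> `|e|%:~R * b%:~R ^+ 2 <= Y ->
  (e, (a, b)) \in params Y.
Proof.
move=> Y0 e0 ab0 ha hb; apply/flatten_mapP; exists `|e|%N.
  rewrite mem_iota add1n ltnS absz_gt0 e0 /= truncn_ge_nat //.
  have sq_ge1 (c : int) : c != 0 -> 1 <= c%:~R ^+ 2 :> R.
    move=> c0; rewrite -rmorphXn /= -[1](rmorph1 intr) ler_int.
    by rewrite -gtz0_ge1 exprn_even_gt0.
  rewrite natr_absz; case/orP: ab0 => /sq_ge1 h.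
    by apply: le_trans ha; rewrite ler_peMr.
  by apply: le_trans hb; rewrite ler_peMr.
apply/allpairsPdep; exists e, (a, b); split=> //.
  by rewrite !inE abszE; case: (ler0P e); rewrite ?opprK eqxx ?orbT.
apply/allpairsPdep; exists a, b.
by split=> //; apply: mem_box_side; rewrite ?absz_gt0 // natr_absz.
Qed.

(** For n <= Y the box side k is at least 1, so the two signs of e contribute 2 (2k + 1)^2 <= 18 k^2
    <= 18 Y / n triples. The harmonic sum gives the logarithm. *)
Lemma size_params Y : 1 <= Y -> (size (params Y))%:R <= 18 * Y * (1 + ln Y).
Proof.
move=> Y1; have Y0 : 0 <= Y by rewrite (le_trans ler01).
set N := Num.truncn Y.
have N0 : (0 < N)%N by rewrite /N truncn_gt0.
have -> : size (params Y) =
    (\sum_(1 <= n < N.+1) 2 * ((box_side Y n).*2.+1 * (box_side Y n).*2.+1))%N.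
  rewrite /params size_flatten sumnE /shape -map_comp big_map /index_iota subSS subn0.
  have sz T U (s : seq T) (t : seq U) :
    size [seq (x, y) | x <- s, y <- t] = (size s * size t)%N := size_allpairs pair s t.
  by apply: eq_bigr => n _; rewrite [LHS]sz sz size_map size_iota.
rewrite natr_sum; apply: (@le_trans _ _ (18 * Y * \sum_(1 <= n < N.+1) n%:R^-1)).
  rewrite mulr_sumr big_nat_cond [leRHS]big_nat_cond; apply: ler_sum => n.
  rewrite andbT => /andP[n0 nN]; set k := box_side Y n.
  have n0R : 0 < n%:R :> R by rewrite ltr0n.
  have nY : n%:R <= Y by rewrite -truncn_ge_nat.
  have k1 : (0 < k)%N.
    rewrite /k /box_side truncn_gt0 -[leLHS]sqrtr1 ler_wsqrtr //.
    by rewrite ler_pdivlMr // mul1r.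
  have k2 : k%:R ^+ 2 <= Y / n%:R.
    rewrite -[leRHS]sqr_sqrtr ?divr_ge0 //.
    by rewrite lerXn2r ?nnegrE ?sqrtr_ge0 // truncn_le ?sqrtr_ge0.
  apply: (@le_trans _ _ (18 * k%:R ^+ 2)); last by rewrite -mulrA ler_wpM2l.
  by rewrite -!(natrX, natrM) ler_nat; nia.
rewrite ler_wpM2l ?mulr_ge0 //.
apply: le_trans (harmonic_sum_le _ N0) _; rewrite lerD2l ler_ln ?posrE ?ltr0n //.
  by rewrite truncn_le.
exact: lt_le_trans Y1.
Qed.

End ParameterBox.

(* numq reads off A and B, which are integers for the parameters of interest. *)
Definition param_pair (p : int * (int * int)) : (int * int) * set Qbar_point :=
  let e : rat := p.1%:~R in let a : rat := p.2.1%:~R in let b : rat := p.2.2%:~R in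
  let r := e * b ^+ 2 / 9 in let s := - e * a ^+ 2 / 3 in
  let A := e ^+ 2 * a * b * (b ^+ 2 + 3 * a * b + 3 * a ^+ 2) / 27 in
  let B := - (r + s) * (r ^+ 2 + s ^+ 2 + 2 * A) / 4 in
  ((numq A, numq B), order3_subgroup A B r).

Lemma two_kernels_param (R : realType) (A B : int) (r s : rat) (H : R) :
  0 <= H -> `|A%:~R| <= H ^+ 2 -> `|B%:~R| <= H ^+ 3 ->
  three_division A%:~R B%:~R r = 0 -> three_division A%:~R B%:~R s = 0 -> r != s ->
  exists2 p, p \in params (27 * H) &
    ((A, B), order3_subgroup A%:~R B%:~R r) = param_pair p.
Proof.
move=> H0 hA hB r_root s_root neq_rs.
have [e [a [b [e0 ab0 Dr Ds DA]]]] := two_roots_param r_root s_root neq_rs.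
have root_le (t : rat) : three_division A%:~R B%:~R t = 0 -> `|ratr t| <= 3 * H.
  move=> t_root; apply: (three_division_root_le H0 hA hB).
  have /(congr1 (@ratr R)) := t_root; rewrite /three_division.
  by rewrite rmorph0 rmorphB !rmorphD !(rmorphXn, rmorphM) /= !ratr_int !rmorph_nat.
exists (e, (a, b)).
  (* From |s| = |e| a^2 / 3 <= 3H and |r| = |e| b^2 / 9 <= 3H come |e| a^2 <= 9H and |e| b^2 <= 27H;
     hence the 27. *)
  apply: mem_params => //; first by rewrite mulr_ge0.
  - have := root_le _ s_root; rewrite Ds !(rmorphXn, rmorphM, rmorphN, fmorphV) /=.
    rewrite !ratr_int !rmorph_nat !(normrX, normrM, normrN, normfV).
    rewrite real_normK ?num_real // -intr_norm !(@ger0_norm _ _%:R) //.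
    by move: H0; lra.
  - have := root_le _ r_root; rewrite Dr !(rmorphXn, rmorphM, rmorphN, fmorphV) /=.
    rewrite !ratr_int !rmorph_nat !(normrX, normrM, normrN, normfV).
    rewrite real_normK ?num_real // -intr_norm !(@ger0_norm _ _%:R) //.
    by move: H0; lra.
rewrite /param_pair /= -Dr -Ds -DA -(two_roots_B r_root s_root neq_rs).
by rewrite !numq_int.
Qed.

(** * Comparison of [N3] and [N3'] *)

Section Counting.
Variable R : realType.
Implicit Types (X : R) (E : int * int).

Lemma height_bound X (A B : int) : 0 <= X -> (height (A, B))%:~R <= X ->
  `|A%:~R| <= (X `^ (1 / 6)) ^+ 2 /\ `|B%:~R| <= (X `^ (1 / 6)) ^+ 3.
Proof.
move=> X0; set H := X `^ (1 / 6).
have H0 : 0 <= H by exact: powR_ge0.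
have H6 : H ^+ 6 = X.
  rewrite -powR_mulrn // -powRrM (_ : 1 / 6 * 6%:R = 1) ?powRr1 //.
  by field.
rewrite /height /= -H6 => h.
have [hA hB] : `|4 * A%:~R ^+ 3| <= H ^+ 6 /\ `|27 * B%:~R ^+ 2| <= H ^+ 6.
  have -> : 4 * A%:~R ^+ 3 = (4 * A ^+ 3)%:~R :> R by rewrite rmorphM rmorphXn.
  have -> : 27 * B%:~R ^+ 2 = (27 * B ^+ 2)%:~R :> R by rewrite rmorphM rmorphXn.
  rewrite -!intr_norm.
  by split; apply: le_trans h; rewrite ler_int le_max lexx ?orbT.
split.
  rewrite -(@ler_pXn2r _ 3) ?nnegrE ?exprn_ge0 // -exprM.
  apply: le_trans hA; rewrite normrM normrX ger0_norm // ler_peMl ?exprn_ge0 //.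
  lra.
rewrite -(@ler_pXn2r _ 2) ?nnegrE ?exprn_ge0 // -exprM.
apply: le_trans hB; rewrite normrM normrX ger0_norm // ler_peMl ?exprn_ge0 //.
lra.
Qed.

(** Finiteness makes the cardinals of [fset_set] in [N3] and [N3'] the true counts. *)
Lemma finite_calE_le X : 0 <= X -> finite_set (@calE_le R X).
Proof.
move=> X0; pose k i := Num.truncn ((X `^ (1 / 6)) ^+ i).
apply: (@sub_finite_set _ _ ([set` int_range (k 2)] `*` [set` int_range (k 3)])).
  move=> [A B] [_ /(height_bound X0)[hA hB]]; split=> /=; rewrite mem_int_range.
    by rewrite -[leLHS]/(Posz `|A|) lez_nat truncn_ge_nat ?exprn_ge0 ?powR_ge0 //
       natr_absz intr_norm.
  by rewrite -[leLHS]/(Posz `|B|) lez_nat truncn_ge_nat ?exprn_ge0 ?powR_ge0 //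
     natr_absz intr_norm.
by apply: finite_setX; exact: finite_seq.
Qed.

(** The first projection maps the pairs onto the curves, which gives the lower bound. For the upper
    bound, one chosen pair per curve accounts for [N3 X], and every other pair comes from
    [params]. *)
Lemma N3'_sub_N3 X : 0 <= X ->
  (N3 X <= N3' X <= N3 X + size (params (27 * X `^ (1 / 6))))%N.
Proof.
move=> X0; rewrite /N3 /N3'; set S := [set E | _]; set S' := [set EC | _].
set Y := 27 * _.
have DS : S = fst @` S'.
  apply/seteqP; split=> [E [EX [phi phiE]]|_ [[E C] [/= EX [phi phiE _]] <-]].
    by exists (E, isogeny_kernel E.1%:~R E.2%:~R phi) => //; split=> //; exists phi.
  by split=> //; exists phi.
have finS : finite_set S by apply: sub_finite_set (finite_calE_le X0) => E [].
(* [g] chooses a pair above E; the default [(E, set0)] is taken only for E outside [S]. *)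
pose g E : (int * int) * set Qbar_point := xget (E, set0) [set EC | S' EC /\ EC.1 = E].
have gP E : S E -> S' (g E) /\ (g E).1 = E.
  rewrite DS => -[EC S'EC DE].
  pose fibre := [set EC | S' EC /\ EC.1 = E].
  have ex_EC : exists EC, fibre EC by exists EC.
  exact: (xgetPex (E, set0) ex_EC).
have S'sub : S' `<=` g @` S `|` param_pair @` [set` params Y].
  move=> [E C] S'EC.
  have SE : S E by rewrite DS; exists (E, C).
  have [gEC|neq_gEC] := pselect (g E = (E, C)); first by left; exists E.
  right; have [/= S'g g1] := gP E SE.
  have [[[ns _] hE] _] := SE.
  have kerP D : S' (E, D) ->
      exists2 x : rat, three_division E.1%:~R E.2%:~R x = 0 &
        D = order3_subgroup E.1%:~R E.2%:~R x.
    by move=> [_ [phi /(three_isogeny_kernel ns)[x x0 Dker] /= ->]]; exists x.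
  have [r r_root DC] := kerP C S'EC.
  have [|s s_root DgC] := kerP (g E).2; first by rewrite -{1}g1 -surjective_pairing.
  (* Here r comes from C and s from the chosen kernel; equal roots would give equal kernels. *)
  have neq_rs : r != s.
    apply: contra_notN neq_gEC => /eqP Drs.
    by rewrite (surjective_pairing (g E)) g1 DgC DC Drs.
  case: E {S'EC SE neq_gEC S'g g1 ns kerP DgC} hE r_root s_root DC => A B hE.
  have [hA hB] := height_bound X0 hE; move=> r_root s_root ->.
  have [p pY Dp] := two_kernels_param (powR_ge0 _ _) hA hB r_root s_root neq_rs.
  by exists p.
have finP : finite_set [set` params Y] by exact: finite_seq.
have finT : finite_set (g @` S `|` param_pair @` [set` params Y]).
  by rewrite finite_setU; split; apply: finite_image.
have finS' := sub_finite_set S'sub finT.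
apply/andP; split.
  by rewrite DS fset_set_image // leq_imfset_card.
move: S'sub; rewrite fset_set_sub // => /fsubset_leq_card/leq_trans; apply.
rewrite fset_setU; [|exact: finite_image|exact: finite_image].
apply: (leq_trans (leq_card_fsetU _ _)).
rewrite !fset_set_image // leq_add ?leq_imfset_card //.
apply: (leq_trans (leq_imfset_card _ _ _)) => /=.
have -> : fset_set [set` params Y] = [fset x in params Y]%fset.
  by apply/fsetP => x; apply/idP/idP; rewrite in_fset_set // !inE.
by rewrite card_fseq size_undup.
Qed.

End Counting.

Theorem proposition2p10 (R : realType) :
  exists C : R, \forall X \near +oo,
    `|(N3' X)%:R - (N3 X)%:R| <= C * (X `^ (1 / 6) * ln X).
Proof.
(* With H = X^(1/6), [size_params] at Y = 27H gives 18 * 27 H (1 + ln (27H)). For large X both ln 27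
   and ln H are at most ln X and 1 <= ln X, so the last factor is at most 3 ln X. *)
exists (18 * 27 * 3); near=> X.
have X27 : 27 <= X by near: X; exact: nbhs_pinfty_ge.
have Xe : expR 1 <= X by near: X; apply: nbhs_pinfty_ge; exact: num_real.
have Xgt0 : 0 < X by lra.
have X0 : 0 <= X := ltW Xgt0.
have /andP[le1 le2] := N3'_sub_N3 X0.
rewrite -natrB // ger0_norm //; set H := X `^ (1 / 6) in le2 *.
have lnX1 : 1 <= ln X.
  by rewrite -[leLHS](expRK 1) ler_ln ?posrE ?expR_gt0.
have H1 : 1 <= H.
  by rewrite -(powRr0 X) ler_powR //; lra.
have Y1 : 1 <= 27 * H by lra.
apply: (@le_trans _ _ (18 * (27 * H) * (1 + ln (27 * H)))).
  apply: le_trans (size_params Y1).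
  by rewrite ler_nat leq_subLR.
have : ln (27 * H) <= ln X + ln X.
  rewrite lnM ?posrE //; last by lra.
  apply: lerD; first by rewrite ler_ln ?posrE //; lra.
  by rewrite ln_powR ler_piMl //; lra.
move=> h; have : H * (1 + ln (27 * H)) <= H * (3 * ln X) by rewrite ler_wpM2l //; lra.
lra.
Unshelve. all: by end_near.
Qed.
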